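(* Let $\pi\in(0,\tfrac12)$, $m=\|\mu\|_2>0$, $\delta>0$ with $\delta<\delta^*(0)$. For $\tau\in(0,\infty)$ let $\rho^*,\beta_0^*=\beta_0^*(\tau)$ be the asymptotic SVM parameters and let $\mathrm{Err}_+^*,\mathrm{Err}_-^*,\mathrm{Err}_{\rm b}^*$ be the asymptotic minority, majority and balanced test errors of the margin-rebalanced SVM with hyperparameter $\tau$ (see context). Suppose $\tau^{\rm opt}>0$ is a minimizer $$\tau^{\rm opt}=\arg\min_{\tau}\mathrm{Err}_{\rm b}^*=\arg\min_\tau\{\Phi(-\rho^*\|\mu\|_2-\beta_0^* )+\Phi(-\rho^*\|\mu\|_2+\beta_0^* )\}.$$ Then, for $\tau=\tau^{\rm opt}$, one has $\beta_0^*=0$ and $\mathrm{Err}_+^*=\mathrm{Err}_-^*=\mathrm{Err}_{\rm b}^*$.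
   Context: Let $(Y,G)$ be independent, $\mathbb P(Y=+1)=\pi=1-\mathbb P(Y=-1)$, $G\sim\mathsf N(0,1)$; $s(+1)=\tau$, $s(-1)=1$; $a_+=\max\{a,0\}$; $\Phi$ the standard normal CDF. Define $$H_\kappa(\rho,\beta_0)=\frac{1-\rho^2}{\mathbb E[(s(Y)\kappa-\rho\|\mu\|_2+G-\beta_0Y)_+^2]},\qquad \delta^*(\kappa)=\max_{\rho\in[-1,1],\,\beta_0\in\mathbb R}H_\kappa(\rho,\beta_0);$$ $\delta^*(0)$ does not depend on $\tau$. For $\delta<\delta^*(0)$, $(\rho^*,\beta_0^*,\kappa^* )$ denotes the unique solution of: maximize $\kappa$ over $\rho\in[-1,1],\beta_0\in\mathbb R,\kappa\in\mathbb R$ subject to $H_\kappa(\rho,\beta_0)\ge\delta$. These are the limits (in probability), as $n,d\to\infty$, $n/d\to\delta$, of the cosine $\langle\hat\beta,\mu\rangle/(\|\hat\beta\|\|\mu\|)$, intercept and margin of the margin-rebalanced SVM: maximize $\kappa$ over $\|\beta\|_2\le1,\beta_0,\kappa$ subject to $y_i(\langle x_i,\beta\rangle+\beta_0)\ge s(y_i)\kappa$ for all $i$, for i.i.d. data $\mathbb P(y_i=+1)=\pi$, $x_i\mid y_i\sim\mathsf N(y_i\mu,I_d)$. The limiting test errors are $$\mathrm{Err}_+^*=\Phi(-\rho^*\|\mu\|_2-\beta_0^* ),\quad \mathrm{Err}_-^*=\Phi(-\rho^*\|\mu\|_2+\beta_0^* ),\quad \mathrm{Err}_{\rm b}^*=\tfrac12\mathrm{Err}_+^*+\tfrac12\mathrm{Err}_-^*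 .$$ Here $\rho^*$ does not depend on $\tau$. The minimization is over $\tau\in(0,\infty)$. *)

(* Defs.v *)
From mathcomp Require Export all_boot all_order all_algebra.
From mathcomp Require Export all_classical all_reals all_analysis.
Export numFieldNormedType.Exports.

Set Implicit Arguments.
Unset Strict Implicit.
Unset Printing Implicit Defensive.

Import Order.TTheory GRing.Theory Num.Theory.
Local Open Scope classical_set_scope.
Local Open Scope ring_scope.

Definition indep_RV (d : measure_display) (T : measurableType d) (R : realType)
    (P : probability T R) (X Z : {RV P >-> R}) : Prop :=
  forall A B : set R, measurable A -> measurable B ->
    P (X @^-1` A `&` Z @^-1` B) = (P (X @^-1` A) * P (Z @^-1` B))%E.

Definition Phi (R : realType) (x : R) : R := fine (normal_prob 0 1 `]-oo, x]).

(* s(+1) = tau and s(-1) = 1; Y takes other values only on a null set. *)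
Definition sfun (R : realType) (tau y : R) : R := if y == 1 then tau else 1.

(* m stands for the norm of mu. *)
Definition H (d : measure_display) (T : measurableType d) (R : realType)
    (P : probability T R) (Y G : {RV P >-> R}) (m tau kappa rho beta0 : R) : R :=
  (1 - rho ^+ 2) /
  fine 'E_P[fun w : T =>
    Num.max (sfun tau (Y w) * kappa - rho * m + G w - beta0 * Y w) 0 ^+ 2].

(* The maximum is attained, so it equals this sup; [sup] is 0 on a set that is
   empty or not bounded above, so [delta < delta_star] with [0 < delta] forces
   the set of values to be bounded above. *)
Definition delta_star (d : measure_display) (T : measurableType d)
    (R : realType) (P : probability T R) (Y G : {RV P >-> R})
    (m tau kappa : R) : R :=
  sup [set h | exists rho beta0 : R,
         -1 <= rho <= 1 /\ h = H Y G m tau kappa rho beta0].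

Lemma delta_star0_tau (d : measure_display) (T : measurableType d)
    (R : realType) (P : probability T R) (Y G : {RV P >-> R}) (m tau tau' : R) :
  delta_star Y G m tau 0 = delta_star Y G m tau' 0.
Proof.
congr sup; apply/seteqP; split=> h /= [rho [beta0 [hrho ->]]];
  exists rho, beta0; split=> //; rewrite /H; congr (_ / fine ('E_P[_]));
  by apply/funext => w; rewrite !mulr0.
Qed.

Definition svm_feasible (d : measure_display) (T : measurableType d)
    (R : realType) (P : probability T R) (Y G : {RV P >-> R})
    (m delta tau rho beta0 kappa : R) : Prop :=
  -1 <= rho <= 1 /\ delta <= H Y G m tau kappa rho beta0.

(* (rho, beta0, kappa) maximizes kappa over the feasible triples. Uniqueness of
   the maximizer is not part of the predicate. *)
Definition svm_solution (d : measure_display) (T : measurableType d)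
    (R : realType) (P : probability T R) (Y G : {RV P >-> R})
    (m delta tau rho beta0 kappa : R) : Prop :=
  svm_feasible Y G m delta tau rho beta0 kappa /\
  forall rho' beta0' kappa' : R,
    svm_feasible Y G m delta tau rho' beta0' kappa' -> kappa' <= kappa.

Definition Err_plus (R : realType) (m rho beta0 : R) : R :=
  Phi (- (rho * m) - beta0).

Definition Err_minus (R : realType) (m rho beta0 : R) : R :=
  Phi (- (rho * m) + beta0).

Definition Err_bal (R : realType) (m rho beta0 : R) : R :=
  2^-1 * Err_plus m rho beta0 + 2^-1 * Err_minus m rho beta0.

(* Main.v *)
(** In the coordinates u = tau * kappa - beta0, v = kappa + beta0 the feasible
    set is 1 - rho^2 >= delta * q (u - rho * m) (v - rho * m), where q is the
    expectation of the squared hinge loss, and maximizing kappa means maximizing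
    u + v; tau has disappeared. Since q is strictly convex and increasing, the
    maximizer (rho, u, v) is unique, hence common to all tau, and rho > 0: at
    rho <= 0 a small increase of rho decreases q to first order and decreases
    1 - rho^2 to second order at most. As tau varies, beta0 = (tau * v - u) / (1 + tau)
    sweeps an open interval, on which a nonzero beta0 can be moved towards 0.
    With rho > 0 this strictly decreases the balanced error, because the normal
    density decreases away from 0. Hence the optimal beta0 is 0.

    The expectations are finite because 0 < delta < delta_star forces one value
    of H to be positive, so that one of them is finite (an infinite one would
    have [fine] equal to 0), and this one bounds all the others. *)
Require Import Defs.
From mathcomp Require Import measurable_realfun ring lra.

Set Implicit Arguments.
Unset Strict Implicit.
Unset Printing Implicit Defensive.

Import Order.TTheory GRing.Theory Num.Theory.
Local Open Scope classical_set_scope.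
Local Open Scope ring_scope.

(** * The convex program in the coordinates [u], [v] *)

Section Convex_program.
Context (R : realType) (m delta : R) (q : R -> R -> R).
Hypothesis hm : 0 < m.
Hypothesis hdelta0 : 0 < delta.
Hypothesis q_convex : forall t a b a' b', 0 <= t <= 1 ->
  q ((1 - t) * a + t * a') ((1 - t) * b + t * b')
    <= (1 - t) * q a b + t * q a' b'.
Hypothesis q_strict : forall a b a' b', (a, b) <> (a', b') ->
  q ((a + a') / 2) ((b + b') / 2) < (q a b + q a' b') / 2.
Hypothesis q_mono : forall a b h, 0 < h -> q a b < q (a + h) (b + h).

Definition feasible (r u v : R) : Prop :=
  -1 <= r <= 1 /\ delta * q (u - r * m) (v - r * m) <= 1 - r ^+ 2.

Definition optimal (r u v : R) : Prop :=
  feasible r u v /\ forall r' u' v', feasible r' u' v' -> u' + v' <= u + v.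

(** By convexity along the diagonal, a step [h] in [0, 1] raises the cost by at most [h * D], where
    [D] is the rise over a unit step; [h = s / (s + D)] keeps this within the slack [s]. *)
Lemma slack_feasible r u v : -1 <= r <= 1 ->
  delta * q (u - r * m) (v - r * m) < 1 - r ^+ 2 ->
  exists2 h, 0 < h & feasible r (u + h) (v + h).
Proof.
move=> r1; set a := u - r * m; set b := v - r * m => slack.
pose s := 1 - r ^+ 2 - delta * q a b.
pose D := delta * (q (a + 1) (b + 1) - q a b).
have s0 : 0 < s by rewrite subr_gt0.
have D0 : 0 < D by rewrite mulr_gt0// subr_gt0 q_mono.
have sD0 : 0 < s + D by lra.
have h0 : 0 < s / (s + D) by rewrite divr_gt0.
have h1 : s / (s + D) <= 1 by rewrite ler_pdivrMr//; lra.
have hD : s / (s + D) * D <= s.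
  by rewrite mulrAC ler_pdivrMr// ler_pM2l//; lra.
set h := s / (s + D) in h0 h1 hD *.
exists h => //; split=> //.
have h01 : 0 <= h <= 1 by rewrite h1 ltW.
have := q_convex a b (a + 1) (b + 1) h01.
rewrite (_ : _ * a + _ = u + h - r * m); last by rewrite /a; ring.
rewrite (_ : _ * b + _ = v + h - r * m); last by rewrite /b; ring.
move/(ler_wpM2l (ltW hdelta0))/le_trans; apply.
by move: hD; rewrite /D /s; lra.
Qed.

(** Any slack could be spent on raising both [u'] and [v'], beating the optimal sum. *)
Lemma optimal_tight r u v r' u' v' : optimal r u v -> -1 <= r' <= 1 ->
  u + v <= u' + v' ->
  1 - r' ^+ 2 <= delta * q (u' - r' * m) (v' - r' * m).
Proof.
move=> [_ opt] r'1 uv; rewrite leNgt; apply/negP => slack.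
have [h h0 /opt] := slack_feasible r'1 slack; lra.
Qed.

(** The midpoint of two optima has the same sum, so its constraint has no slack. Strict convexity of
    [q], or strict concavity of [1 - r ^+ 2] when the arguments of [q] agree, would create some. *)
Lemma optimal_unique r u v r' u' v' :
  optimal r u v -> optimal r' u' v' -> [/\ r = r', u = u' & v = v'].
Proof.
move=> ho ho'.
have [[/andP[r1 r2] fe] opt] := ho; have [[/andP[r1' r2'] fe'] opt'] := ho'.
have uv : u + v <= u' + v' by exact: opt' ho.1.
have uv' : u' + v' <= u + v by exact: opt ho'.1.
have r3 : -1 <= (r + r') / 2 <= 1 by apply/andP; split; lra.
have := optimal_tight (u' := (u + u') / 2) (v' := (v + v') / 2) ho r3.
move/(_ ltac:(lra)).
set a := u - r * m in fe *; set b := v - r * m in fe *.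
set a' := u' - r' * m in fe' *; set b' := v' - r' * m in fe' *.
rewrite (_ : (u + u') / 2 - _ = (a + a') / 2); last by rewrite /a /a'; lra.
rewrite (_ : (v + v') / 2 - _ = (b + b') / 2); last by rewrite /b /b'; lra.
have sq := sqr_ge0 (r - r').
have [[ea eb]|ab] := pselect ((a, b) = (a', b')); last first.
  by have := q_strict ab; rewrite -(ltr_pM2l hdelta0) => lt1 le1; exfalso; nra.
rewrite -ea -eb in fe' *.
rewrite (_ : (a + a) / 2 = a); last lra.
rewrite (_ : (b + b) / 2 = b); last lra.
move=> le1; have /eqP : (r - r') ^+ 2 = 0 by apply: le_anti; rewrite sq andbT; nra.
rewrite sqrf_eq0 subr_eq0 => /eqP rr'.
by split=> //; move: ea eb; rewrite /a /a' /b /b' rr'; lra.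
Qed.

Lemma optimal_rho_gt0 r u v : optimal r u v -> 0 < r.
Proof.
move=> ho; rewrite ltNge; apply/negP => r0.
have [[/andP[r1 r2] fe] _] := ho.
set a := u - r * m in fe; set b := v - r * m in fe.
(* With [u], [v] fixed, raising [r] by [h] in [0, 1] lowers the cost by at least [h * c], by
   convexity, while for [r <= 0] the bound [1 - r ^+ 2] drops by at most [h ^+ 2]. Hence a choice of
   [h] below both 1 and [c]. *)
pose c := delta * (q a b - q (a - m) (b - m)).
have c0 : 0 < c.
  rewrite mulr_gt0// subr_gt0.
  by have := q_mono (a - m) (b - m) hm; rewrite !subrK.
pose h := c / (c + 1).
have h0 : 0 < h by rewrite divr_gt0//; lra.
have h1 : h < 1 by rewrite ltr_pdivrMr; lra.
have hc : h < c by rewrite ltr_pdivrMr; nra.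
have rh : -1 <= r + h <= 1 by apply/andP; split; lra.
have := optimal_tight ho rh (lexx _).
have h01 : 0 <= h <= 1 by rewrite !ltW.
have := q_convex a b (a - m) (b - m) h01.
rewrite (_ : _ * a + _ = u - (r + h) * m); last by rewrite /a; ring.
rewrite (_ : _ * b + _ = v - (r + h) * m); last by rewrite /b; ring.
rewrite -(ler_pM2l hdelta0) => le1 le2.
have : h * h < h * c by rewrite ltr_pM2l.
have : r * h <= 0 by rewrite pmulr_lle0.
by move: le1 le2 fe; rewrite /c; nra.
Qed.

End Convex_program.

(** * The standard normal distribution *)

Section Normal_distribution.
Context (R : realType).
Implicit Types a b c x y : R.

Lemma normal_pdf_le x y : `|x| <= `|y| -> normal_pdf 0 1 y <= normal_pdf 0 1 x.
Proof.
move=> xy; rewrite !normal_pdfE ?oner_neq0// ler_pM2l ?normal_peak_gt0//.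
rewrite /normal_fun !subr0 ler_expR ler_pM2r ?invr_gt0// ?lerN2 ?expr1n//.
by rewrite -(real_normK (num_real x)) -(real_normK (num_real y)) lerXn2r.
Qed.

Lemma normal_pdf_lt x y : `|x| < `|y| -> normal_pdf 0 1 y < normal_pdf 0 1 x.
Proof.
move=> xy; rewrite !normal_pdfE ?oner_neq0// ltr_pM2l ?normal_peak_gt0//.
rewrite /normal_fun !subr0 ltr_expR ltr_pM2r ?invr_gt0// ?ltrN2 ?expr1n//.
by rewrite -(real_normK (num_real x)) -(real_normK (num_real y)) ltrXn2r.
Qed.

Lemma integrable_cst_itv a b c :
  (@lebesgue_measure R).-integrable `]a, b] (EFin \o cst c).
Proof.
apply: measurable_bounded_integrable => //.
  by rewrite /= lebesgue_measure_itv/=; case: ifP => _; rewrite -?EFinB ltry.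
exact: bounded_cst.
Qed.

Lemma Rintegral_cst_itv a b c : a <= b ->
  \int[@lebesgue_measure R]_(x in `]a, b]) cst c x = c * (b - a).
Proof.
move=> ab; rewrite Rintegral_cst//= lebesgue_measure_itv/= lte_fin.
by case: ltgtP ab => // -> _; rewrite subrr.
Qed.

Lemma integrable_normal_pdf_itv a b :
  (@lebesgue_measure R).-integrable `]a, b] (EFin \o normal_pdf 0 1).
Proof.
by apply: integrableS (integrable_normal_pdf 0 1) => //; exact: subsetT.
Qed.

Lemma normal_prob_itv_ge a b c : a <= b ->
  (forall x, a < x <= b -> c <= normal_pdf 0 1 x) ->
  c * (b - a) <= fine (normal_prob 0 1 `]a, b]).
Proof.
move=> ab cle; rewrite -Rintegral_cst_itv//; apply: le_Rintegral => //.
- exact: integrable_cst_itv.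
- exact: integrable_normal_pdf_itv.
Qed.

Lemma normal_prob_itv_le a b c : a <= b ->
  (forall x, a < x <= b -> normal_pdf 0 1 x <= c) ->
  fine (normal_prob 0 1 `]a, b]) <= c * (b - a).
Proof.
move=> ab cle; rewrite -Rintegral_cst_itv//; apply: le_Rintegral => //.
- exact: integrable_normal_pdf_itv.
- exact: integrable_cst_itv.
Qed.

Lemma normal_prob_ray_gt0 a : 0 < fine (normal_prob 0 1 `]a, +oo[).
Proof.
apply: (@lt_le_trans _ _ (fine (normal_prob 0 1 `]a, a + 1]))); last first.
  rewrite fine_le ?fin_num_measure//; apply: le_measure; rewrite ?inE//= => x /=.
  by rewrite !in_itv/= andbT => /andP[].
(* Every point of []a, a + 1]] has modulus at most [|a| + 1], which bounds the density from
   below. *)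
apply: (@lt_le_trans _ _ (normal_pdf 0 1 (`|a| + 1) * (a + 1 - a))).
  rewrite mulr_gt0//; last by rewrite addrC addKr.
  rewrite normal_pdfE ?oner_neq0// mulr_gt0 ?normal_peak_gt0 ?oner_neq0//.
  exact: expR_gt0.
apply: normal_prob_itv_ge => [|x /andP[ax xa]]; first lra.
apply: normal_pdf_le; rewrite ler_norml.
have := ler_norm a; have := ler_norm (- a); rewrite normrN => ? ?.
by rewrite ger0_norm; lra.
Qed.

Lemma Phi_sub a b : a <= b -> Phi b - Phi a = fine (normal_prob 0 1 `]a, b]).
Proof.
move=> ab; rewrite /Phi (_ : `]-oo, b] = `]-oo, a] `|` `]a, b])%classic; last first.
  by rewrite -itv_bndbnd_setU ?bnd_simp.
rewrite measureU//; last first.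
  apply/seteqP; split=> x //=; rewrite !in_itv/= => -[xa /andP[ax _]].
  by move: ax; rewrite ltNge xa.
by rewrite fineD ?fin_num_measure// addrAC subrr add0r.
Qed.

(* The window [ ]-a+b', -a+b] ] lies closer to the origin than
   [ ]-a-b, -a-b'] ], which has the same length. *)
Lemma Phi_sum_lt a b' b : 0 < a -> 0 < b' < b -> b - b' < 2 * a ->
  Phi (- a - b') + Phi (- a + b') < Phi (- a - b) + Phi (- a + b).
Proof.
move=> a0 /andP[b'0 b'b] bb'.
suff : Phi (- a - b') - Phi (- a - b) < Phi (- a + b) - Phi (- a + b') by lra.
rewrite !Phi_sub; [|lra|lra].
(* [far] is the least modulus on the left window, [near] bounds the modulus on the other;
   [b - b' < 2 * a] enters in [near < far]. *)
pose far := a + b'; pose near := Num.max `|- a + b'| `|- a + b|.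
have near_far : near < far.
  by rewrite /near /far gt_max !ltr_norml; apply/andP; split; apply/andP; lra.
have near0 : 0 <= near by rewrite le_max normr_ge0.
apply: (@le_lt_trans _ _ (normal_pdf 0 1 far * (- a - b' - (- a - b)))).
  apply: normal_prob_itv_le => [|x /andP[ax xa]]; first lra.
  by apply: normal_pdf_le; rewrite /far ger0_norm ?ler0_norm; lra.
apply: (@lt_le_trans _ _ (normal_pdf 0 1 near * (- a + b - (- a + b')))).
  rewrite (_ : - a - b' - _ = b - b'); last by ring.
  rewrite (_ : - a + b - _ = b - b'); last by ring.
  rewrite ltr_pM2r ?subr_gt0//.
  by apply: normal_pdf_lt; rewrite !ger0_norm// ltW// (le_lt_trans near0).
apply: normal_prob_itv_ge => [|x /andP[ax xa]]; first lra.
apply: normal_pdf_le; rewrite [leRHS]ger0_norm//.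
rewrite /near le_max; apply/orP; case: (ltP x 0) => x0; [left|right].
  by rewrite !ltr0_norm; lra.
by rewrite !ger0_norm; lra.
Qed.

End Normal_distribution.

(** * The squared positive part *)

Section Squared_positive_part.
Context (R : realDomainType).
Implicit Types x y h t : R.

Lemma max0_ge0 x : 0 <= Num.max x 0.
Proof. by rewrite le_max lexx orbT. Qed.

Lemma sqr_max0_le x y : x <= y -> Num.max x 0 ^+ 2 <= Num.max y 0 ^+ 2.
Proof.
move=> xy; rewrite lerXn2r ?nnegrE ?max0_ge0//.
by rewrite ge_max !le_max xy lexx orbT.
Qed.

(** The positive part is convex, and the square is convex and increasing on nonnegative numbers. *)
Lemma sqr_max0_convex t x y : 0 <= t <= 1 ->
  Num.max ((1 - t) * x + t * y) 0 ^+ 2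
    <= (1 - t) * Num.max x 0 ^+ 2 + t * Num.max y 0 ^+ 2.
Proof.
move=> /andP[t0 t1].
set X := Num.max x 0; set Z := Num.max y 0.
have X0 : 0 <= X by exact: max0_ge0.
have Z0 : 0 <= Z by exact: max0_ge0.
have xX : x <= X by rewrite le_max lexx.
have yZ : y <= Z by rewrite le_max lexx.
have t1' : 0 <= 1 - t by rewrite subr_ge0.
have XZ0 : 0 <= (1 - t) * X + t * Z by rewrite addr_ge0// mulr_ge0.
apply: (@le_trans _ _ (((1 - t) * X + t * Z) ^+ 2)).
  rewrite lerXn2r ?nnegrE ?max0_ge0// ge_max XZ0 andbT.
  by rewrite lerD// ler_wpM2l.
rewrite -subr_ge0 (_ : _ - _ = t * (1 - t) * (X - Z) ^+ 2); last by ring.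
by rewrite mulr_ge0 ?sqr_ge0// mulr_ge0.
Qed.

(** Serves to dominate one hinge loss by another, so that integrability carries over. *)
Lemma sqr_max0_shift x y h : x <= y + h -> 0 <= h ->
  Num.max x 0 ^+ 2 <= 2 * Num.max y 0 ^+ 2 + 2 * h ^+ 2.
Proof.
move=> xyh h0; set Z := Num.max y 0.
have Z0 : 0 <= Z by exact: max0_ge0.
have yZ : y <= Z by rewrite le_max lexx.
apply: (@le_trans _ _ ((Z + h) ^+ 2)).
  rewrite lerXn2r ?nnegrE ?addr_ge0 ?max0_ge0// ge_max.
  by rewrite addr_ge0// andbT (le_trans xyh)// lerD2r.
rewrite -subr_ge0 (_ : _ - _ = (Z - h) ^+ 2); last by ring.
exact: sqr_ge0.
Qed.

End Squared_positive_part.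

(** * Real-valued integrals against a probability *)

Lemma integrable_lin (d : measure_display) (T : measurableType d)
    (R : realType) (P : probability T R) (f g : T -> R) (s t : R) :
  P.-integrable setT (EFin \o f) -> P.-integrable setT (EFin \o g) ->
  P.-integrable setT (EFin \o (fun x => s * f x + t * g x)).
Proof.
move=> intf intg.
have /= intsf := integrableZl measurableT s intf.
have /= inttg := integrableZl measurableT t intg.
exact: (integrableD measurableT intsf inttg).
Qed.

Lemma Rintegral_lin (d : measure_display) (T : measurableType d)
    (R : realType) (P : probability T R) (f g : T -> R) (s t : R) :
  P.-integrable setT (EFin \o f) -> P.-integrable setT (EFin \o g) ->
  \int[P]_x (s * f x + t * g x) = s * \int[P]_x f x + t * \int[P]_x g x.
Proof.
move=> intf intg; rewrite RintegralD ?RintegralZl//.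
- exact: (integrableZl measurableT s intf).
- exact: (integrableZl measurableT t intg).
Qed.

(** [g] dominates [f + c * \1_B], whose integral exceeds that of [f] by [c] times the mass of
    [B]. *)
Lemma lt_Rintegral (d : measure_display) (T : measurableType d) (R : realType)
    (P : probability T R) (f g : T -> R) (B : set T) (c : R) :
  P.-integrable setT (EFin \o f) -> P.-integrable setT (EFin \o g) ->
  (forall x, f x <= g x) -> measurable B -> 0 < fine (P B) -> 0 < c ->
  (forall x, B x -> f x + c <= g x) ->
  \int[P]_x f x < \int[P]_x g x.
Proof.
move=> intf intg fg mB PB0 c0 fgB.
have intB : P.-integrable setT (EFin \o (\1_B : T -> R)).
  exact: integrable_indic.
apply: (@lt_le_trans _ _ (\int[P]_x (1 * f x + c * \1_B x))).
  rewrite Rintegral_lin// mul1r ltrDl.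
  by rewrite /Rintegral integral_indic// setIT mulr_gt0.
apply: le_Rintegral => //; first exact: integrable_lin.
move=> x _; rewrite mul1r indicE; have [/set_mem /fgB|_] := boolP (x \in B).
  by rewrite mulr1.
by rewrite mulr0 addr0.
Qed.

(** * The expected squared hinge loss *)

Section Hinge_loss.
Context (R : realType) (d : measure_display) (T : measurableType d).
Context (P : probability T R) (Y G : {RV P >-> R}).

Definition hinge_loss (a b : R) (w : T) : R :=
  Num.max ((if Y w == 1 then a else b) + G w) 0 ^+ 2.

Definition risk (a b : R) : R := \int[P]_w hinge_loss a b w.

Lemma measurable_hinge_loss a b : measurable_fun setT (hinge_loss a b).
Proof.
apply: measurable_funX; apply: (measurable_maxr (g := cst 0)) => //.
apply: measurable_funD => //; apply: measurable_fun_ifT => //.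
by apply: measurable_fun_eqr.
Qed.

Context (p : R) (p01 : 0 < p < 1).
Hypothesis hYp : P [set w | Y w = 1] = p%:E.
Hypothesis hYm : P [set w | Y w = -1] = (1 - p)%:E.

Lemma Y_pm1_ae : {ae P, forall w, Y w = 1 \/ Y w = -1}.
Proof.
pose A y := Y @^-1` [set y].
have mA y : measurable (A y) by exact: measurable_funPTI.
exists (~` (A 1 `|` A (-1))); split.
- by apply: measurableC; exact: measurableU.
- rewrite probability_setC; last exact: measurableU.
  rewrite measureU//; last first.
    by apply/seteqP; split=> // w []; rewrite /A /= => -> ?; lra.
  transitivity (1 - (p%:E + (1 - p)%:E))%E; first by congr (1 - (_ + _))%E.
  rewrite -EFinD. by congr (_%:E); ring.
- by move=> w.
Qed.

(** The integrands agree only where the label is 1 or -1, that is, almost surely. *)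
Lemma H_risk m tau kappa rho beta0 :
  H Y G m tau kappa rho beta0 = (1 - rho ^+ 2) /
    risk (tau * kappa - beta0 - rho * m) (kappa + beta0 - rho * m).
Proof.
congr (_ / fine _); rewrite unlock; apply: ge0_ae_eq_integral => //=.
- apply/measurable_EFinP; apply: measurable_funX.
  apply: (measurable_maxr (g := cst 0)) => //.
  apply: measurable_funB; last by apply: measurable_funM.
  apply: measurable_funD => //; apply: measurable_funB => //.
  apply: measurable_funM => //; apply: measurable_fun_ifT => //.
  by apply: measurable_fun_eqr.
- by apply/measurable_EFinP; exact: measurable_hinge_loss.
- by move=> w _; rewrite lee_fin sqr_ge0.
- by move=> w _; rewrite lee_fin sqr_ge0.
apply: filterS Y_pm1_ae => w Yw _; rewrite /hinge_loss /sfun.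
congr (Num.max _ _ ^+ 2)%:E.
have N1 : (-1 == 1 :> R) = false by apply/negP => /eqP; lra.
by case: Yw => ->; rewrite ?eqxx ?N1; ring.
Qed.

(** An infinite integral is turned into 0 by [fine]. *)
Lemma risk_neq0_integrable a b : risk a b != 0 ->
  P.-integrable setT (EFin \o hinge_loss a b).
Proof.
move=> r0; apply/integrableP; split.
  by apply/measurable_EFinP; exact: measurable_hinge_loss.
rewrite (eq_integral (EFin \o hinge_loss a b)); last first.
  by move=> w _ /=; rewrite ger0_norm// sqr_ge0.
move: r0; rewrite /risk /Rintegral.
by case: integral => [r||] /=; rewrite ?ltry ?eqxx.
Qed.

Lemma integrable_hinge_loss a b a' b' :
  P.-integrable setT (EFin \o hinge_loss a b) ->
  P.-integrable setT (EFin \o hinge_loss a' b').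
Proof.
(* [h] bounds the change of offset under either label. *)
move=> intab; pose h := `|a' - a| + `|b' - b|.
have h0 : 0 <= h by rewrite addr_ge0.
apply: (@le_integrable _ _ _ P _ _ _
    (EFin \o (fun w => 2 * hinge_loss a b w + 2 * cst (h ^+ 2) w))) => //.
- by apply/measurable_EFinP; exact: measurable_hinge_loss.
- move=> w _ /=; rewrite lee_fin !ger0_norm ?sqr_ge0//; last first.
    by rewrite addr_ge0// mulr_ge0// sqr_ge0.
  apply: sqr_max0_shift => //; rewrite -addrA (addrC (G w)) addrA lerD2r.
  have := ler_norm (a' - a); have := ler_norm (b' - b).
  have := normr_ge0 (a' - a); have := normr_ge0 (b' - b).
  by rewrite /h; case: ifP => _; lra.
by apply: integrable_lin => //; exact: finite_measure_integrable_cst.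
Qed.

Hypothesis hG : forall A : set R, measurable A ->
  distribution P G A = normal_prob 0 1 A.
Hypothesis hYG : indep_RV Y G.

(** Independence gives a product of two positive factors. These events, on which chosen hinges are
    active, are the source of strict inequalities between risks. *)
Lemma label_tail_gt0 y c K : P [set w | Y w = y] = c%:E -> 0 < c ->
  0 < fine (P (Y @^-1` [set y] `&` G @^-1` `]K, +oo[)).
Proof.
move=> Pc c0; rewrite hYG// [P (Y @^-1` _)]Pc.
rewrite [P (G @^-1` _)](hG (measurable_itv `]K, +oo[)).
by rewrite fineM ?fin_num_measure//= mulr_gt0// normal_prob_ray_gt0.
Qed.

Hypothesis int_hinge : forall a b, P.-integrable setT (EFin \o hinge_loss a b).

Lemma hinge_loss_convex t a b a' b' w : 0 <= t <= 1 ->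
  hinge_loss ((1 - t) * a + t * a') ((1 - t) * b + t * b') w
    <= (1 - t) * hinge_loss a b w + t * hinge_loss a' b' w.
Proof.
move=> /sqr_max0_convex ht; apply: le_trans (ht _ _).
by rewrite /hinge_loss; case: ifP => _; apply: sqr_max0_le; lra.
Qed.

Lemma risk_convex t a b a' b' : 0 <= t <= 1 ->
  risk ((1 - t) * a + t * a') ((1 - t) * b + t * b')
    <= (1 - t) * risk a b + t * risk a' b'.
Proof.
move=> t01; rewrite -Rintegral_lin//; apply: le_Rintegral => //.
  exact: integrable_lin.
by move=> w _; exact: hinge_loss_convex.
Qed.

(** Where both hinges are active the loss is a plain square, whose midpoint gap does not depend on
    [G]. A label that sees the differing coordinate, with [G] large, provides such an event. *)
Lemma risk_strictly_convex a b a' b' : (a, b) <> (a', b') ->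
  risk ((a + a') / 2) ((b + b') / 2) < (risk a b + risk a' b') / 2.
Proof.
move=> ab; rewrite [ltRHS]mulrC mulrDr -Rintegral_lin//.
have conv w : hinge_loss ((a + a') / 2) ((b + b') / 2) w
    <= 2^-1 * hinge_loss a b w + 2^-1 * hinge_loss a' b' w.
  have t01 : 0 <= (2^-1 : R) <= 1 by apply/andP; split; lra.
  have := hinge_loss_convex a b a' b' w t01.
  rewrite (_ : 1 - 2^-1 = 2^-1 :> R); last lra.
  by rewrite !(mulrC 2^-1) -!mulrDl.
have gap (x x' g : R) : - x < g -> - x' < g ->
    Num.max ((x + x') / 2 + g) 0 ^+ 2 + ((x - x') / 2) ^+ 2
    <= 2^-1 * Num.max (x + g) 0 ^+ 2 + 2^-1 * Num.max (x' + g) 0 ^+ 2.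
  move=> xg x'g; rewrite !max_l; [|lra|lra|lra].
  by rewrite le_eqVlt; apply/orP; left; apply/eqP; field.
have half_sqr_gt0 (x x' : R) : x != x' -> 0 < ((x - x') / 2) ^+ 2.
  by move=> xx'; rewrite exprn_even_gt0//= mulf_neq0 ?subr_eq0// invr_neq0.
have mB y K : measurable (Y @^-1` [set y] `&` G @^-1` `]K, +oo[).
  by apply: measurableI; exact: measurable_funPTI.
have [aa'|aa'] := eqVneq a a'; last first.
  pose K := Num.max (- a) (- a').
  apply: (@lt_Rintegral _ _ _ _ _ _ (Y @^-1` [set 1] `&` G @^-1` `]K, +oo[)
      (((a - a') / 2) ^+ 2)) => //.
  - exact: integrable_lin.
  - by apply: label_tail_gt0 hYp _; case/andP: p01.
  - exact: half_sqr_gt0.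
  move=> w [/= Yw]; rewrite in_itv/= andbT gt_max => /andP[ag ag'].
  by rewrite /hinge_loss Yw eqxx; exact: gap.
have bb' : b != b' by apply: contra_notN ab => /eqP ->; rewrite aa'.
pose K := Num.max (- b) (- b').
apply: (@lt_Rintegral _ _ _ _ _ _ (Y @^-1` [set -1] `&` G @^-1` `]K, +oo[)
    (((b - b') / 2) ^+ 2)) => //.
- exact: integrable_lin.
- by apply: label_tail_gt0 hYm _; case/andP: p01; rewrite subr_gt0.
- exact: half_sqr_gt0.
move=> w [/= Yw]; rewrite in_itv/= andbT gt_max => /andP[bg bg'].
have N1 : (-1 == 1 :> R) = false by apply/negP => /eqP; lra.
by rewrite /hinge_loss Yw N1; exact: gap.
Qed.

(** Shifting an active hinge by [h] adds at least [h ^+ 2] to the loss, and label 1 with [G > - a]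
    makes it active. *)
Lemma risk_mono a b h : 0 < h -> risk a b < risk (a + h) (b + h).
Proof.
move=> h0.
apply: (@lt_Rintegral _ _ _ _ _ _ (Y @^-1` [set 1] `&` G @^-1` `]- a, +oo[)
    (h ^+ 2)) => //.
- move=> w; apply: sqr_max0_le; rewrite lerD2r.
  by case: ifP => _; rewrite lerDl ltW.
- by apply: measurableI; exact: measurable_funPTI.
- by apply: label_tail_gt0 hYp _; case/andP: p01.
- exact: exprn_gt0.
move=> w [/= Yw]; rewrite in_itv/= andbT => ag.
rewrite /hinge_loss Yw eqxx !max_l; [|lra|lra].
have : 0 <= a + G w by lra.
nra.
Qed.

(** It strictly exceeds the nonnegative risk at [(a - 1, b - 1)]. *)
Lemma risk_gt0 a b : 0 < risk a b.
Proof.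
rewrite -[a](subrK 1) -[b](subrK 1); apply: le_lt_trans (risk_mono _ _ ltr01).
by apply: Rintegral_ge0 => w _; exact: sqr_ge0.
Qed.

End Hinge_loss.

(** * Elimination of [tau] *)

Section Reparametrization.
Context (R : realType) (d : measure_display) (T : measurableType d).
Context (P : probability T R) (Y G : {RV P >-> R}) (p m delta : R).
Hypothesis hYp : P [set w | Y w = 1] = p%:E.
Hypothesis hYm : P [set w | Y w = -1] = (1 - p)%:E.
Hypothesis risk_pos : forall a b, 0 < risk Y G a b.

Lemma svm_feasibleE tau rho beta0 kappa :
  svm_feasible Y G m delta tau rho beta0 kappa <->
  feasible m delta (risk Y G) rho (tau * kappa - beta0) (kappa + beta0).
Proof.
by rewrite /svm_feasible (H_risk G hYp hYm) ler_pdivlMr.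
Qed.

(* [(beta0, kappa) |-> (tau * kappa - beta0, kappa + beta0)] is a bijection
   under which [kappa] becomes the sum of the coordinates over [1 + tau]. *)
Lemma svm_solution_optimal tau rho beta0 kappa : 0 < tau ->
  svm_solution Y G m delta tau rho beta0 kappa ->
  optimal m delta (risk Y G) rho (tau * kappa - beta0) (kappa + beta0).
Proof.
move=> tau0 [/svm_feasibleE feas opt]; split=> // r' u' v' feas'.
have tau1 : 0 < 1 + tau by lra.
pose k' := (u' + v') / (1 + tau).
have ek' : (1 + tau) * k' = u' + v' by rewrite mulrC divfK// gt_eqF.
have : k' <= kappa.
  apply: (opt r' (v' - k')); apply/svm_feasibleE.
  rewrite (_ : tau * k' - (v' - k') = u'); last by move: ek'; lra.
  by rewrite (_ : k' + (v' - k') = v'); last by ring.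
by rewrite -(ler_pM2l tau1) ek'; lra.
Qed.

End Reparametrization.

(** * The optimal intercept *)

Theorem proposition1p2 (R : realType) (d : measure_display)
    (T : measurableType d) (P : probability T R) (Y G : {RV P >-> R})
    (p m delta tau_opt : R) (rho beta0 kappa : R -> R)
    (hp : 0 < p < 2^-1)
    (hYp : P [set w | Y w = 1] = p%:E)
    (hYm : P [set w | Y w = -1] = (1 - p)%:E)
    (hG : forall A : set R, measurable A ->
       distribution P G A = normal_prob 0 1 A)
    (hYG : indep_RV Y G)
    (hm : 0 < m)
    (hdelta0 : 0 < delta)
    (hdelta : delta < delta_star Y G m tau_opt 0)
    (hsol : forall tau : R, 0 < tau ->
       svm_solution Y G m delta tau (rho tau) (beta0 tau) (kappa tau))
    (htau0 : 0 < tau_opt)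
    (htau : forall tau : R, 0 < tau ->
       Err_bal m (rho tau_opt) (beta0 tau_opt)
         <= Err_bal m (rho tau) (beta0 tau)) :
  beta0 tau_opt = 0 /\
  Err_plus m (rho tau_opt) (beta0 tau_opt)
    = Err_minus m (rho tau_opt) (beta0 tau_opt) /\
  Err_minus m (rho tau_opt) (beta0 tau_opt)
    = Err_bal m (rho tau_opt) (beta0 tau_opt).
Proof.
have p01 : 0 < p < 1 by case/andP: hp => *; apply/andP; split; lra.
(* This point with zero margin and strict slack yields both the finiteness of all risks and the
   positivity of the optimal margin. *)
have [h [r0 [b0 [r01 ->]]]] : exists2 h, (exists rho beta0 : R,
    -1 <= rho <= 1 /\ h = H Y G m tau_opt 0 rho beta0) & delta < h.
  apply: sup_gt hdelta.
  by exists (H Y G m tau_opt 0 0 0), 0, 0; split=> //; apply/andP; split; lra.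
rewrite (H_risk G hYp hYm) mulr0 !add0r => H_gt.
have int_hinge a b : P.-integrable setT (EFin \o hinge_loss Y G a b).
  apply: (@integrable_hinge_loss _ _ _ _ _ _ (- b0 - r0 * m) (b0 - r0 * m)).
  apply: risk_neq0_integrable; apply: contraTneq H_gt => ->.
  by rewrite invr0 mulr0 -leNgt ltW.
have q_gt0 := risk_gt0 p01 hYp hG hYG int_hinge.
have q_mono := risk_mono p01 hYp hG hYG int_hinge.
have q_convex := risk_convex int_hinge.
have q_strict := risk_strictly_convex p01 hYp hYm hG hYG int_hinge.
have sol tau : 0 < tau -> optimal m delta (risk Y G) (rho tau)
    (tau * kappa tau - beta0 tau) (kappa tau + beta0 tau).
  move=> tau0; exact: (svm_solution_optimal hYp hYm q_gt0 tau0 (hsol _ tau0)).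
have opt := sol _ htau0.
have rho_gt0 := optimal_rho_gt0 hm hdelta0 q_convex q_mono opt.
(* The zero-margin point has coordinate sum 0; its slack buys a feasible point with sum
   [2 * e > 0]. *)
have kappa_gt0 : 0 < kappa tau_opt.
  rewrite ltr_pdivlMr// in H_gt.
  have [e e0 feas] := slack_feasible hdelta0 q_convex q_mono r01 H_gt.
  have /= := opt.2 _ _ _ feas => le_sum.
  have : 0 < (1 + tau_opt) * kappa tau_opt by lra.
  by rewrite pmulr_rgt0//; lra.
set b := beta0 tau_opt in opt htau *; set k := kappa tau_opt in opt kappa_gt0 *.
set r := rho tau_opt in opt htau rho_gt0 *.
have a_gt0 : 0 < r * m by rewrite mulr_gt0.
have tk_gt0 : 0 < tau_opt * k by rewrite mulr_gt0.
(* every intercept in the open interval [(-u, v)] is reached by some [tau] *)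
have attain b' : b - tau_opt * k < b' < b + k ->
    Phi (- (r * m) - b) + Phi (- (r * m) + b)
      <= Phi (- (r * m) - b') + Phi (- (r * m) + b').
  move=> /andP[ub' b'v].
  have v_gt : 0 < k + b - b' by lra.
  have u_gt : 0 < tau_opt * k - b + b' by lra.
  (* Intercept [b'] at the common optimum forces margin [k + b - b']; [t] then solves the equation
     for the first coordinate. *)
  pose t := (tau_opt * k - b + b') / (k + b - b').
  have t0 : 0 < t by rewrite divr_gt0.
  have et : t * (k + b - b') = tau_opt * k - b + b' by rewrite divfK// gt_eqF.
  have [er eu ev] := optimal_unique hdelta0 q_convex q_strict q_mono opt (sol _ t0).
  have eb : beta0 t = b'.
    suff : kappa t = k + b - b' by lra.
    have t1 : 1 + t != 0 by rewrite gt_eqF//; lra.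
    by apply: (mulfI t1); lra.
  have := htau t t0.
  by rewrite /Err_bal /Err_plus /Err_minus -er eb; lra.
have b0E : b = 0.
  (* The intercept moves towards 0 by [M / 2]: the first two bounds keep it attainable, [|b|]
     preserves its sign, and the last meets the width condition of [Phi_sum_lt]. *)
  pose M := Num.min (Num.min (tau_opt * k) k) (Num.min `|b| (2 * (r * m))).
  apply/eqP; apply: contraT => b_neq0.
  have M0 : 0 < M by rewrite !lt_min tk_gt0 kappa_gt0 normr_gt0 b_neq0; lra.
  have M1 : M <= tau_opt * k by rewrite !ge_min lexx.
  have M2 : M <= k by rewrite !ge_min lexx orbT.
  have M3 : M <= `|b| by rewrite !ge_min lexx !orbT.
  have M4 : M <= 2 * (r * m) by rewrite !ge_min lexx !orbT.
  move: b_neq0 M3; rewrite neq_lt => /orP[bneg|bpos].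
    rewrite ltr0_norm// => M3.
    (* The sum of the two errors is even in the intercept, so the comparison is applied to [- b]. *)
    have lt1 : 0 < - b - M / 2 < - b by apply/andP; split; lra.
    have lt2 : b - tau_opt * k < b + M / 2 < b + k by apply/andP; split; lra.
    have lt3 : - b - (- b - M / 2) < 2 * (r * m) by lra.
    have := attain _ lt2; have := Phi_sum_lt a_gt0 lt1 lt3.
    rewrite (_ : - (r * m) - (- b - M / 2) = - (r * m) + (b + M / 2)); last ring.
    rewrite (_ : - (r * m) + (- b - M / 2) = - (r * m) - (b + M / 2)); last ring.
    by rewrite opprK; lra.
  rewrite gtr0_norm// => M3.
  have lt1 : 0 < b - M / 2 < b by apply/andP; split; lra.
  have lt2 : b - tau_opt * k < b - M / 2 < b + k by apply/andP; split; lra.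
  have lt3 : b - (b - M / 2) < 2 * (r * m) by lra.
  have := Phi_sum_lt a_gt0 lt1 lt3; have := attain _ lt2; lra.
rewrite b0E /Err_bal /Err_plus /Err_minus subr0 addr0; split=> //; split=> //.
lra.
Qed.
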